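(* Let $G$ be a Lie group modelled on a Silva space. Then $G$ is Weil complete.
   Context: A locally convex space $E$ is called a Silva space if it is the locally convex direct limit $E=\varinjlim E_n$ of an ascending sequence $E_1\subseteq E_2\subseteq\cdots$ of Banach spaces such that each inclusion map $E_n\to E_{n+1}$ is a compact (linear) operator. A topological group is called Weil complete if it is complete in its left uniformity, i.e., every Cauchy net (or Cauchy filter) with respect to the left uniform structure converges. Locally convex spaces are real or complex Hausdorff locally convex topological vector spaces. Smoothness is understood in the sense of Keller's $C^\infty_c$-theory: for locally convex spaces $E,F$ over $\mathbb{K}\in\{\mathbb{R},\mathbb{C}\}$ and $U\subseteq E$ open, a map $f\colon U\to F$ is $C^\infty$ if it is continuous and, for each $k\in\mathbb{N}$, the iterated directional derivatives $d^{(k)}f(x,y_1,\ldots,y_k)=(D_{y_k}\cdots D_{y_1}f)(x)$ (over $\mathbb{K}$) exist for all $x\in U$, $y_1,\ldots,y_k\in E$ and define continuous maps $d^{(k)}f\colon U\times E^k\to F$. A Lie group modelled on $E$ is a group $G$ endowed with a smooth manifold structure modelled on $E$ (with Hausdorff underlying topology, charts being homeomorphisms onto open subsets of $E$ with smooth transition maps) such that the group multiplication and inversion are smooth; in particular, $G$ is a Hausdorff topological group. *)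

(* Defs.v *)
From HB Require Import structures.
From mathcomp Require Import all_boot all_order all_algebra.
From mathcomp Require Import complex.
From mathcomp Require Import all_classical all_reals all_analysis.

Set Implicit Arguments.
Unset Strict Implicit.
Unset Printing Implicit Defensive.

Import Order.TTheory GRing.Theory Num.Theory.
Import numFieldNormedType.Exports.

Local Open Scope classical_set_scope.
Local Open Scope ring_scope.

Inductive real_or_complex (R : realType) : numFieldType -> Prop :=
| RealScalars : real_or_complex R R
| ComplexScalars : real_or_complex R R[i].

(* [tvsType K] is local convexity without the Hausdorff axiom, so
   [hausdorff_space] is stated explicitly wherever a locally convex space is
   meant. *)

Definition compact_operator (K : numFieldType) (V W : normedModType K)
    (s : V -> W) : Prop :=
  forall B : set V, bounded_set B -> precompact (s @` B).

(* The subspaces [V 0 `<=` V 1 `<=` ...] of E are represented by injective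
   linear maps [j n : V n -> E], and the inclusion of [V n] in [V n.+1] by
   [s n].  The last field says that the topology of E is the finest locally
   convex topology making every [j n] continuous. *)
Record silva_limit (K : numFieldType) (E : tvsType K)
    (V : nat -> completeNormedModType K)
    (s : forall n, {linear V n -> V n.+1})
    (j : forall n, {linear V n -> E}) : Prop := {
  silva_inj : forall n, injective (j n) ;
  silva_step : forall n v, j n.+1 (s n v) = j n v ;
  silva_cover : forall x : E, exists n, exists v : V n, j n v = x ;
  silva_compact : forall n, compact_operator (s n) ;
  silva_continuous : forall n, continuous (j n) ;
  silva_universal : forall (F : tvsType K) (f : {linear E -> F}),
    hausdorff_space F ->
    (forall n, continuous (fun v : V n => f (j n v))) -> continuous f
}.

Definition silva_space (K : numFieldType) (E : tvsType K) : Prop :=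
  hausdorff_space E /\ exists V s j, @silva_limit K E V s j.

(* Keller's C^oo_c.  The witness [d [:: y1; ...; yk] x] is the iterated
   directional derivative [(D_yk ... D_y1 f) x]; on the open set U it is
   determined by f as soon as F is Hausdorff.  The values of f and d outside U
   are irrelevant. *)
Definition smooth_on (K : numFieldType) (E F : tvsType K) (U : set E)
    (f : E -> F) : Prop :=
  exists d : seq E -> E -> F,
  [/\ forall x, U x -> d [::] x = f x,
      forall (ys : seq E) (y x : E), U x ->
        t^-1 *: (d ys (x + t *: y) - d ys x) @[t --> (0 : K)^']
          --> d (rcons ys y) x
    & forall k : nat,
        {within U `*` setT,
          continuous (fun xy : E * {ptws 'I_k -> E} =>
                        d [seq xy.2 i | i <- enum 'I_k] xy.1)}].

(* A chart is the bijection [fwd : dom -> fwd @` dom] with inverse [bwd]; both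
   maps are arbitrary outside of these sets. *)
Record chart (M E : Type) := Chart {
  dom : set M ;
  fwd : M -> E ;
  bwd : E -> M
}.

Definition cod (M E : Type) (c : chart M E) : set E := fwd c @` dom c.

Definition is_chart (M E : topologicalType) (c : chart M E) : Prop :=
  [/\ open (dom c), open (cod c),
      forall x, dom c x -> bwd c (fwd c x) = x,
      {within dom c, continuous (fwd c)}
    & {within cod c, continuous (bwd c)}].

Definition is_atlas (K : numFieldType) (E : tvsType K) (M : topologicalType)
    (A : set (chart M E)) : Prop :=
  [/\ forall c, A c -> is_chart c,
      forall x : M, exists2 c, A c & dom c x
    & forall c c', A c -> A c' ->
        smooth_on (fwd c @` (dom c `&` dom c')) (fwd c' \o bwd c)].

Definition smooth_map (K : numFieldType) (E F : tvsType K)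
    (M N : topologicalType) (A : set (chart M E)) (B : set (chart N F))
    (f : M -> N) : Prop :=
  continuous f /\
  forall a b, A a -> B b ->
    smooth_on (fwd a @` (dom a `&` f @^-1` dom b)) (fwd b \o f \o bwd a).

Definition prod_chart (M N E F : Type) (a : chart M E) (b : chart N F) :
    chart (M * N) (E * F) :=
  Chart (dom a `*` dom b) (fun x => (fwd a x.1, fwd b x.2))
        (fun v => (bwd a v.1, bwd b v.2)).

Definition prod_atlas (M N E F : Type)
    (A : set (chart M E)) (B : set (chart N F)) :
    set (chart (M * N) (E * F)) :=
  [set c | exists a b, [/\ A a, B b & c = prod_chart a b]].

(* Group structure and topology on the same carrier, with no compatibility
   required. *)
#[short(type="preTopologicalGroupType")]
HB.structure Definition PreTopologicalGroup :=
  {G of Topological G & Group G}.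

Record lie_group (K : numFieldType) (E : tvsType K)
    (G : preTopologicalGroupType) (A : set (chart G E)) : Prop := {
  lie_hausdorff : hausdorff_space G ;
  lie_atlas : is_atlas A ;
  lie_mul : smooth_map (prod_atlas A A) A (fun x : G * G => (x.1 * x.2)%g) ;
  lie_inv : smooth_map A A (fun x : G => x^-1%g)
}.

Definition left_entourage (G : preTopologicalGroupType) : set_system (G * G) :=
  [set W | exists2 V, nbhs (1%g : G) V &
           [set xy | V (xy.1^-1 * xy.2)%g] `<=` W].

Definition left_cauchy (G : preTopologicalGroupType) (F : set_system G) :
    Prop :=
  (F, F) --> @left_entourage G.

Definition weil_complete (G : preTopologicalGroupType) : Prop :=
  forall F : set_system G, ProperFilter F -> left_cauchy F ->
    exists x : G, F --> x.

(* Main.v *)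
From HB Require Import structures.
From mathcomp Require Import complex.
Require Import Defs.
From mathcomp Require Import all_boot all_order all_algebra.
From mathcomp Require Import all_classical all_reals all_analysis.

(** A Silva space [E] is a k_omega-space, and this topological property, needed
    only at one point, already forces completeness.

    In [E], images of balls of the Banach steps have compact closures one step
    further, which gives an exhaustion of [E] by compact convex sets [C n] such
    that a convex set absorbing all of them is a neighbourhood of [0]
    ([silva_compact_exhaustion]).  A set [W] containing [0] whose traces on the
    [C n] are relatively open is then a neighbourhood of [0], as it contains a
    union of sums [e 0 *: C 0 + ... + e n *: C n] with suitably small [e i]
    ([exh_komega]).  A chart around [1] carries this property over to [G]
    ([komega_at_chart]).

    So there are increasing compact sets [L n] in [G] that detect neighbourhoods
    of [1].  A left Cauchy filter converges to each of its cluster points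
    ([left_cauchy_cluster]).  One without cluster points would, for any compact
    set, have a closed member missing that set, and from these members one
    builds a neighbourhood of [1] that violates the Cauchy property
    ([komega_weil_complete]).  Of the Lie group structure, only the continuity
    of the multiplication and one chart at [1] enter. *)

Set Implicit Arguments.
Unset Strict Implicit.
Unset Printing Implicit Defensive.

Import Order.TTheory GRing.Theory Num.Theory.
Import numFieldNormedType.Exports.

Local Open Scope classical_set_scope.
Local Open Scope ring_scope.

(** * k_omega-germs and left Cauchy filters in groups *)

(** A k_omega-germ at [x]: an increasing sequence of compact sets through
    [x] whose union is a neighbourhood of [x], and which detects neighbourhoods
    of [x], in the sense that a set containing [x] whose trace on each [L n] is
    relatively open is a neighbourhood of [x].  Unlike for a k_omega-space,
    nothing is required of the topology away from [x]. *)
Record komega_at (X : topologicalType) (x : X) (L : nat -> set X) : Prop := {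
  komega_compact : forall n, compact (L n) ;
  komega_sub : forall m n, (m <= n)%N -> L m `<=` L n ;
  komega_mem : forall n, L n x ;
  komega_cover : nbhs x (\bigcup_n L n) ;
  komega_nbhs : forall W : set X, W x ->
    (forall n, exists2 O, open O & L n `&` O = L n `&` W) -> nbhs x W
}.

(** A filter without cluster points in a compact set [M] has a closed member
    which misses [M]. *)
Lemma compact_not_cluster (X : topologicalType) (F : set_system X)
    (M : set X) :
  ProperFilter F -> compact M -> (forall x, M x -> ~ cluster F x) ->
  exists2 A, F A & closed A /\ (forall x, M x -> ~ A x).
Proof.
move=> FF /compact_near_coveringP Mc Mcl.
have PF : Filter (powerset_filter_from F) by exact: powerset_filter_from_filter.
have /Mc [] : forall x, M x -> \forall x' \near x & A \near
    powerset_filter_from F, ~ closure A x'.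
  move=> x /Mcl/existsNP[A /existsNP[N /not_implyP[FA /not_implyP[Nx]]]] AN0.
  exists (interior N, [set B | F B /\ B `<=` A]).
    split=> /=; first exact: nbhs_interior.
    exact: powerset_filter_fromP.
  move=> [y B] /= [Ny [_ BA]] /(_ _ Ny)[z [Bz Nz]].
  by apply: AN0; exists z; split=> //; exact: BA.
move=> /= GG [GF Gdown [B GB]] GP.
exists (closure B); first by apply: filterS (GF _ GB); exact: subset_closure.
by split; [exact: closed_closure|move=> x; exact: GP].
Qed.

Lemma left_cauchyP (G : preTopologicalGroupType) (F : set_system G)
    (FF : Filter F) (V : set G) : left_cauchy F -> nbhs 1%g V ->
  exists2 B : set G, F B & forall x y, B x -> B y -> V (x^-1 * y)%g.
Proof.
move=> FC V1; have [] := FC [set xy | V (xy.1^-1 * xy.2)%g].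
  by exists V.
move=> [B1 B2] /= [FB1 FB2] BV; exists (B1 `&` B2); first exact: filterI.
by move=> x y [xB _] [_ yB]; exact: (BV (x, y)).
Qed.

Lemma left_cauchy_cluster (G : preTopologicalGroupType) (F : set_system G)
    (x : G) :
  continuous (fun p : G * G => (p.1 * p.2)%g) -> ProperFilter F ->
  left_cauchy F -> cluster F x -> F --> x.
Proof.
move=> mulC FF FC Fx U Ux.
have := mulC (x, 1%g) U; rewrite /= mulg1 => /(_ Ux)[[N V] /= [Nx V1] NVU].
have [B FB BV] := left_cauchyP FF FC V1.
have [c [Bc Nc]] := Fx _ _ FB Nx.
apply: filterS FB => y By.
have := NVU (c, (c^-1 * y)%g); rewrite /= mulVKg; apply; split=> //.
exact: BV.
Qed.

Lemma translate_continuous (G : preTopologicalGroupType) (b : G) :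
  continuous (fun p : G * G => (p.1 * p.2)%g) ->
  continuous (fun x : G => (b * x)%g).
Proof.
move=> mulC x; apply: (@continuous_comp _ _ _ (fun x : G => (b, x))
  (fun p : G * G => (p.1 * p.2)%g)); last exact: mulC.
by apply: cvg_pair => /=; [exact: cvg_cst|exact: cvg_id].
Qed.

Lemma open_compact_translates (G : preTopologicalGroupType) (C A : set G) :
  continuous (fun p : G * G => (p.1 * p.2)%g) -> compact C -> closed A ->
  open [set w | forall b, C b -> ~ A (b * w)%g].
Proof.
move=> mulC /compact_near_coveringP Cc Acl; rewrite openE => w Ww.
apply: (Cc _ (nbhs w) (fun w b => ~ A (b * w)%g)) => b Cb.
have : nbhs (b * w)%g (~` A).
  by apply: open_nbhs_nbhs; split; [exact: closed_openC|exact: Ww].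
exact: (mulC (b, w)).
Qed.

(** If a left Cauchy filter [F] had no cluster point, translates [C n] of the
    [L n] would together cover a member of [F], and there would be closed
    members [A n] of [F] missing the compact sets [C n * L n].  The set of all
    [w] such that [C n * w] misses [A n] for every [n] is then a neighbourhood
    of [1]: on [L m], only the finitely many conditions with [n < m] are active.
    This contradicts the Cauchy property. *)
Theorem komega_weil_complete (G : preTopologicalGroupType) (L : nat -> set G) :
  continuous (fun p : G * G => (p.1 * p.2)%g) -> komega_at 1%g L ->
  weil_complete G.
Proof.
move=> mulC [Lc Lsub L1 Lcover Lnbhs] F FF FC.
apply: contrapT => Fdiv.
have nocl x : ~ cluster F x.
  by move=> Fx; apply: Fdiv; exists x; exact: left_cauchy_cluster.
have [B0 FB0 B0L] := left_cauchyP _ FC Lcover.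
have [b0 B0b0] := filter_ex FB0.
pose C n := (fun x => (b0 * x)%g) @` L n.
have Cc n : compact (C n).
  apply: continuous_compact; last exact: Lc.
  exact/continuous_subspaceT/translate_continuous.
have CLc n : compact ((fun p : G * G => (p.1 * p.2)%g) @` (C n `*` L n)).
  apply: continuous_compact; last exact: compact_setX.
  exact/continuous_subspaceT.
have /choice[A AP] n : exists A, [/\ F A, closed A &
    forall b w, C n b -> L n w -> ~ A (b * w)%g].
  have [A FA [Acl AM]] :=
    @compact_not_cluster _ F _ _ (CLc n) (fun x _ => @nocl x).
  by exists A; split => // b w Cb Lw; apply: AM; exists (b, w).
pose W n := [set w | forall b, C n b -> ~ A n (b * w)%g].
have Wo n : open (W n).
  by have [_ ? _] := AP n; exact: open_compact_translates.
have LW m n : (m <= n)%N -> L m `<=` W n.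
  by move=> /Lsub mn w /mn Lw b Cb; have [_ _] := AP n; apply.
have W1 : nbhs 1%g (\bigcap_n W n).
  apply: Lnbhs; first by move=> n _; apply: (LW 0%N) => //.
  move=> n; exists (\bigcap_(k < n) W k).
    rewrite bigcap_mkord; apply: (big_ind (@open G)) => [||k _] //.
      exact: openT.
    exact: openI.
  rewrite eqEsubset; split=> w [Lw Ww]; split=> // k.
    by move=> _; have [kn|/LW] := ltnP k n; [exact: Ww|exact].
  by move=> _; exact: Ww.
(* A member [B] of [F] with [x^-1 * y] in this neighbourhood for all [x, y] in
   [B] meets some [C n] in [b] and then [A n] in [a], while [a = b * (b^-1 * a)]
   should not lie in [A n]. *)
have [B FB BW] := left_cauchyP _ FC W1.
have [b [Bb B0b]] := filter_ex (filterI FB FB0).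
have [n _ Lb] := B0L b0 b B0b0 B0b.
have [FA _ _] := AP n.
have [a [Ba Aa]] := filter_ex (filterI FB FA).
apply: (BW b a Bb Ba n I b); last by rewrite mulVKg.
by exists (b0^-1 * b)%g => //; rewrite mulVKg.
Qed.

(** * Transport of k_omega-germs *)

(** A germ may be cut down to any closed neighbourhood of its base point. *)
Lemma komega_at_closed (X : topologicalType) (x : X) (L : nat -> set X)
    (N : set X) :
  komega_at x L -> closed N -> nbhs x N -> komega_at x (fun n => N `&` L n).
Proof.
move=> [Lc Lsub Lx Lcover Lnbhs] Ncl Nx; split.
- by move=> n; rewrite setIC; exact: compact_closedI.
- by move=> m n /Lsub; exact: setIS.
- by move=> n; split; [exact: nbhs_singleton|exact: Lx].
- by apply: filterS (filterI Nx Lcover) => y [Ny [n _ Ly]]; exists n.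
- move=> W Wx WL; suff WN : nbhs x (W `|` ~` N).
    by apply: filterS (filterI WN Nx) => y [[//|]].
  apply: Lnbhs; first by left.
  move=> n; case: (WL n) => O oO; rewrite eqEsubset => -[OW WO].
  exists (O `|` ~` N); first by apply: openU => //; exact: closed_openC.
  rewrite eqEsubset; split=> y [Ly Oy]; split=> //;
    have [Ny|Ny] := pselect (N y); try (by right); case: Oy => // Oy; left.
    by have [] := OW y.
  by have [] := WO y.
Qed.

(** Germs are transported by maps that are continuous on an open set [U] and
    open at the base point. *)
Lemma komega_at_image (X Y : topologicalType) (f : X -> Y) (U : set X) (x : X)
    (L : nat -> set X) :
  open U -> {within U, continuous f} ->
  (forall A, nbhs x A -> nbhs (f x) (f @` (A `&` U))) ->
  (forall n, L n `<=` U) ->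
  komega_at x L -> komega_at (f x) (fun n => f @` L n).
Proof.
move=> oU cf fo LU [Lc Lsub Lx Lcover Lnbhs].
have Ux : U x by apply: (LU 0%N); exact: Lx.
split.
- move=> n; apply: continuous_compact (Lc n).
  exact: continuous_subspaceW cf.
- by move=> m n /Lsub; exact: image_subset.
- by move=> n; exists x.
- by apply: filterS (fo _ Lcover) => _ [y [[n _ Ly] _] <-]; exists n.
- move=> W Wx WL; have : nbhs x (U `&` f @^-1` W).
    apply: Lnbhs => // n; case: (WL n) => O oO; rewrite eqEsubset => -[OW WO].
    exists (U `&` f @^-1` O).
      rewrite openE => y [Uy Oy]; apply: filterI; first exact: open_nbhs_nbhs.
      move: cf; rewrite continuous_open_subspace// => /(_ y (mem_set Uy)).
      by apply; exact: open_nbhs_nbhs.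
    rewrite eqEsubset; split=> y [Ly [Uy Oy]]; split=> //; split=> //=.
      by have [] := OW (f y) (conj (imageP f Ly) Oy).
    by have [] := WO (f y) (conj (imageP f Ly) Oy).
  by move=> /fo; apply: filterS => _ [y [[_ Wy] _] <-].
Qed.

Lemma translate_tvs_continuous (K : numFieldType) (E : tvsType K) (x : E) :
  continuous (+%R x).
Proof.
move=> y A /(@add_continuous E (x, y))[[X Y] [/= Xx Yy] XYA].
apply: filterS Yy => z Yz; apply: (XYA (x, z)).
by split=> //; exact: nbhs_singleton.
Qed.

Lemma komega_at_translate (K : numFieldType) (E : tvsType K) (p : E)
    (L : nat -> set E) :
  komega_at 0 L -> komega_at p (fun n => +%R p @` L n).
Proof.
move=> kL; rewrite -[p in komega_at p _]addr0.
apply: (@komega_at_image _ _ _ setT) => //; first exact: openT.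
  exact/continuous_subspaceT/translate_tvs_continuous.
by move=> A A0; rewrite setIT addr0; exact: nbhsT.
Qed.

Lemma komega_at_chart (K : numFieldType) (E : tvsType K) (M : topologicalType)
    (c : chart M E) (x : M) (L : nat -> set E) :
  is_chart c -> dom c x -> komega_at 0 L -> exists L', komega_at x L'.
Proof.
move=> [od oc bf cf cb] dx /(komega_at_translate (fwd c x)) kL.
have cx : nbhs (fwd c x) (cod c).
  by apply: open_nbhs_nbhs; split=> //; exists x.
have [N Nx Nc] := uniform_regular cx.
have /(komega_at_closed kL (@closed_closure _ N)) kNL :
    nbhs (fwd c x) (closure N).
  by apply: filterS Nx; exact: subset_closure.
rewrite -(bf x dx).
exists (fun n => bwd c @` (closure N `&` (+%R (fwd c x) @` L n))).
apply: (@komega_at_image _ _ _ (cod c)) => //; last first.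
  by move=> n y [/Nc].
move=> A Ax; rewrite bf//.
have xd : nbhs x (dom c) by exact: open_nbhs_nbhs.
move: cf; rewrite continuous_open_subspace// => /(_ x (mem_set dx) A Ax) Ax'.
apply: filterS (filterI xd Ax') => y [dy Ay].
by exists (fwd c y); [split=> //; exists y|exact: bf].
Qed.

(** * Convex sets and continuity in topological vector spaces *)

Lemma convex_setP (K : numFieldType) (E : lmodType K) (A : set E) :
  convex_set A <-> forall (t : K) x y, 0 <= t -> t <= 1 -> A x -> A y ->
    A (t *: x + (1 - t) *: y).
Proof.
split=> [cA t x y t0 t1 Ax Ay|cA x y t /set_mem Ax /set_mem Ay].
  have := cA x y (Itv01 t0 t1) (mem_set Ax) (mem_set Ay).
  by rewrite inE.
by apply/mem_set; apply: cA.
Qed.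

Lemma scaler_continuous (K : numFieldType) (E : tvsType K) (x : E) :
  continuous (fun t : K^o => t *: x).
Proof.
move=> t A /(@scale_continuous K E (t, x))[[T X] [/= Tt Xx] TXA].
apply: filterS Tt => s Ts; apply: (TXA (s, x)).
by split=> //; exact: nbhs_singleton.
Qed.

Lemma add_scale_continuous (K : numFieldType) (E : tvsType K) :
  continuous (fun z : (E * E) * K^o => z.1.1 + z.2 *: z.1.2).
Proof.
move=> [[x y] t] A /(@add_continuous E (x, t *: y))[[X Y] [/= Xx Yy] XYA].
have [[T Z] [/= Tt Zy] TZY] := @scale_continuous K E (t, y) _ Yy.
exists (X `*` Z, T); first by split=> //; exists (X, Z).
move=> [[x' y'] t'] [/= [Xx' Zy'] Tt'].
by apply: (XYA (x', t' *: y')); split=> //=; exact: (TZY (t', y')).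
Qed.

Lemma convex_set_half (K : numFieldType) (E : lmodType K) (A : set E) x y :
  convex_set A -> A (x *+ 2) -> A (y *+ 2) -> A (x + y).
Proof.
move=> /convex_setP cA Ax Ay.
have h : 1 - 2^-1 = 2^-1 :> K by rewrite [X in X - _](splitr 1) mul1r addrK.
have half (z : E) : 2^-1 *: (z *+ 2) = z.
  by rewrite -[z *+ 2]scaler_nat scalerA mulVf ?scale1r// pnatr_eq0.
have := cA 2^-1 _ _ _ _ Ax Ay; rewrite h !half; apply.
  by rewrite invr_ge0.
by rewrite invf_le1// ler1n.
Qed.

Lemma nbhs0_scale_bounded (K : numFieldType) (V : normedModType K) (M : K)
    (A : set V) : 0 < M ->
  nbhs 0 A -> nbhs 0 [set v | forall t : K, `|t| <= M -> A (t *: v)].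
Proof.
move=> M0 /nbhs_norm0P[e /= e0 eA]; apply/nbhs_norm0P.
exists (e / M); first by rewrite /= divr_gt0.
move=> v /= ve t tM; apply: eA => /=; rewrite normrZ.
move: ve; rewrite ltr_pdivlMr//; apply: le_lt_trans.
by rewrite mulrC ler_wpM2l.
Qed.

(** * The finest locally convex topology on a direct limit *)

(** The vector space [E], to be endowed with the finest locally convex topology
    for which all maps [j n] are continuous. *)
Definition fine_lmod (K : numFieldType) (E : lmodType K)
  (V : nat -> normedModType K) (j : forall n, {linear V n -> E}) : Type := E.

HB.instance Definition _ (K : numFieldType) (E : lmodType K)
    (V : nat -> normedModType K) (j : forall n, {linear V n -> E}) :=
  GRing.Lmodule.copy (fine_lmod j) E.

(** The basic neighbourhoods of [0] for this topology.  Absorption is part of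
    the definition because the images of the [j n] are not assumed to cover
    [E]; this makes the topology a vector topology in all cases. *)
Record fine_nbhs0 (K : numFieldType) (E : lmodType K)
    (V : nat -> normedModType K) (j : forall n, {linear V n -> E})
    (U : set E) : Prop := {
  fine_convex : convex_set U ;
  fine_preimage : forall n, nbhs 0 (j n @^-1` U) ;
  fine_absorbing : forall x, nbhs (0 : K^o) (( *:%R^~ x) @^-1` U)
}.

(** The filter of neighbourhoods of [x], obtained by translation. *)
Definition fine_nbhs (K : numFieldType) (E : lmodType K)
    (V : nat -> normedModType K) (j : forall n, {linear V n -> E})
    (x : E) (A : set E) : Prop :=
  exists2 U, fine_nbhs0 j U & forall u, U u -> A (x + u).

Section FineTopology.
Context (K : numFieldType) (E : lmodType K) (V : nat -> normedModType K).
Context (j : forall n, {linear V n -> E}).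

Lemma fine_nbhs0_0 U : fine_nbhs0 j U -> U 0.
Proof. by move=> /fine_absorbing/(_ 0)/nbhs_singleton; rewrite /= scale0r. Qed.

Lemma fine_nbhs0T : fine_nbhs0 j setT.
Proof. by split=> *; [apply/convex_setP|exact: filterT..]. Qed.

Lemma fine_nbhs0I U U' :
  fine_nbhs0 j U -> fine_nbhs0 j U' -> fine_nbhs0 j (U `&` U').
Proof.
move=> [/convex_setP cU pU aU] [/convex_setP cU' pU' aU'].
split; last 2 first.
- by move=> n; exact: filterI (pU n) (pU' n).
- by move=> x; exact: filterI (aU x) (aU' x).
apply/convex_setP => t x y t0 t1 [Ux Ux'] [Uy Uy'].
by split; [apply: cU|apply: cU'].
Qed.

Lemma fine_nbhs0_scale U (M : K) : 0 < M -> fine_nbhs0 j U ->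
  fine_nbhs0 j [set x | forall t : K, `|t| <= M -> U (t *: x)].
Proof.
move=> M0 [/convex_setP cU pU aU]; split.
- apply/convex_setP => t x y t0 t1 Ux Uy s sM.
  rewrite scalerDr !scalerA ![s * _]mulrC -!scalerA.
  by apply: cU => //; [exact: Ux|exact: Uy].
- move=> n; apply: filterS (nbhs0_scale_bounded M0 (pU n)) => v Uv t tM /=.
  by rewrite -linearZ; exact: Uv.
- move=> x; apply: filterS (nbhs0_scale_bounded M0 (aU x)) => s Us t tM /=.
  by rewrite scalerA; exact: Us.
Qed.

Lemma fine_nbhs_filter (x : E) : ProperFilter (fine_nbhs j x).
Proof.
split; first by move=> [U /fine_nbhs0_0 U0 /(_ _ U0)].
split.
- by exists setT => //; exact: fine_nbhs0T.
- move=> A B [U Uf UA] [U' Uf' UB]; exists (U `&` U'); first exact: fine_nbhs0I.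
  by move=> u [/UA ? /UB].
- by move=> A B AB [U Uf UA]; exists U => // u /UA/AB.
Qed.

Lemma fine_nbhs_singleton (x : E) A : fine_nbhs j x A -> A x.
Proof. by move=> [U /fine_nbhs0_0 U0 /(_ _ U0)]; rewrite addr0. Qed.

Lemma fine_nbhs_half U : fine_nbhs0 j U -> exists2 U', fine_nbhs0 j U' &
  forall x y, U' x -> U' y -> U (x + y).
Proof.
move=> Uf; exists [set x | forall t : K, `|t| <= 2 -> U (t *: x)].
  exact: fine_nbhs0_scale.
move=> x y Ux Uy; apply: convex_set_half; first exact: (fine_convex Uf).
  by rewrite -scaler_nat; apply: Ux; rewrite ger0_norm ?ler0n.
by rewrite -scaler_nat; apply: Uy; rewrite ger0_norm ?ler0n.
Qed.

Lemma fine_nbhs_nbhs (x : E) A :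
  fine_nbhs j x A -> fine_nbhs j x ((fine_nbhs j)^~ A).
Proof.
move=> [U /fine_nbhs_half[U' Uf' UU] UA]; exists U' => // u Uu.
by exists U' => // u' Uu'; rewrite -addrA; apply/UA/UU.
Qed.

HB.instance Definition _ := hasNbhs.Build (fine_lmod j) (fine_nbhs j).

HB.instance Definition _ := Nbhs_isNbhsTopological.Build (fine_lmod j)
  fine_nbhs_filter fine_nbhs_singleton fine_nbhs_nbhs.

Lemma nbhs_fineE (x : fine_lmod j) : nbhs x = fine_nbhs j x.
Proof. by []. Qed.

Lemma fine_add_continuous :
  continuous (fun x : fine_lmod j * fine_lmod j => x.1 + x.2).
Proof.
move=> [x y] A [U /fine_nbhs_half[U' Uf' UU] UA].
exists ([set x' | U' (x' - x)], [set y' | U' (y' - y)]) => /=.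
  by split; exists U' => // u Uu /=; rewrite addrC addKr.
move=> [x' y'] /= [Ux Uy].
have := UA _ (UU _ _ Ux Uy).
by rewrite addrACA [x + _]addrC [y + _]addrC !subrK.
Qed.

Lemma fine_scale_continuous :
  continuous (fun z : K^o * fine_lmod j => z.1 *: z.2).
Proof.
move=> [s x] A [U /fine_nbhs_half[U' Uf' UU] UA].
have s0 : 0 < `|s| + 1 by rewrite ltr_wpDl.
exists ([set t : K^o | U' ((t - s) *: x) /\ `|t| <= `|s| + 1],
        [set y | forall t : K, `|t| <= `|s| + 1 -> U' (t *: (y - x))]) => /=.
  split.
    have Us0 : nbhs (0 : K^o) [set t | U' (t *: x) /\ `|t| <= 1].
      exact: filterI (fine_absorbing Uf' x) (nbhs0_le (V:=K^o) ltr01).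
    apply: filterS (nbhsT (s : K^o) Us0) => _ [t [Ut t1] <-].
    rewrite /= [s + t]addrC addrK; split=> //.
    by rewrite addrC (le_trans (ler_normD _ _))// lerD2l.
  exists [set x | forall t : K, `|t| <= `|s| + 1 -> U' (t *: x)].
    exact: fine_nbhs0_scale.
  by move=> u Uu /= t ts; rewrite [x + u]addrC addrK; exact: Uu.
move=> [t y] /= [[Ut ts] Uy].
have := UA _ (UU _ _ Ut (Uy t ts)).
rewrite /= scalerBl scalerBr addrA [s *: x + _]addrC subrK.
by rewrite [t *: x + _]addrC subrK.
Qed.

Lemma fine_locally_convex :
  exists2 B : set_system (fine_lmod j),
    (forall b, b \in B -> convex_set b) & basis B.
Proof.
exists [set b | open b /\ convex_set b].
  by move=> b /set_mem[].
split; first by move=> b [].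
move=> x A [U Uf UA].
pose b : set (fine_lmod j) := [set x' | U (x' - x)].
exists (interior b); last first.
  move=> y /interior_subset /= /UA; by rewrite addrC subrK.
split; last by exists U => // u Uu; rewrite /b/= addrC addKr.
split; first exact: open_interior.
apply/convex_setP => t y z t0 t1 [Y Yf Yb] [Z Zf Zb].
exists (Y `&` Z); first exact: fine_nbhs0I.
move=> u [/Yb Yu /Zb Zu]; rewrite /b /=.
have /convex_setP/(_ t _ _ t0 t1 Yu Zu) := fine_convex Uf.
congr U; rewrite -[y + u - x]addrA -[z + u - x]addrA.
rewrite (scalerDr t y) (scalerDr (1 - t) z) addrACA -scalerDl.
by rewrite [t + _]addrC subrK scale1r addrA.
Qed.

(* The first instance only provides the uniform structure of the topological
   vector space. *)
HB.instance Definition _ := PreTopologicalLmod_isTvs.Build K (fine_lmod j)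
  fine_add_continuous fine_scale_continuous fine_locally_convex.
HB.instance Definition _ := PreTopologicalNmodule_isTopologicalNmodule.Build
  (fine_lmod j) fine_add_continuous.
HB.instance Definition _ := TopologicalNmodule_isTopologicalLmodule.Build
  K (fine_lmod j) fine_scale_continuous.
HB.instance Definition _ :=
  Uniform_isTvs.Build K (fine_lmod j) fine_locally_convex.

Lemma fine_continuous n : continuous (fun v : V n => (j n v : fine_lmod j)).
Proof.
move=> v A [U Uf UA]; apply: filterS (nbhsT v (fine_preimage Uf n)).
by move=> _ [w Uw <-]; rewrite /= linearD; exact: UA.
Qed.

End FineTopology.

(** The fine topology is finer than every locally convex topology making all
    [j n] continuous. *)
Lemma nbhs_fine_nbhs (K : numFieldType) (E : tvsType K)
    (V : nat -> normedModType K) (j : forall n, {linear V n -> E}) (x : E) A :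
  (forall n, continuous (j n)) -> nbhs x A -> fine_nbhs j x A.
Proof.
move=> jC Ax; have [B cB [oB bB]] := @locally_convex K E.
have [b [Bb bx] bA] := bB _ _ Ax.
have b0 : nbhs x b by apply: open_nbhs_nbhs; split=> //; exact: oB.
have b0' : nbhs 0 [set u | b (x + u)].
  by apply: (@translate_tvs_continuous _ _ x 0); rewrite addr0.
exists [set u | b (x + u)]; last by move=> u /bA.
split.
- apply/convex_setP => t y z t0 t1 by_ bz /=.
  have /convex_setP/(_ t _ _ t0 t1 by_ bz) := cB _ (mem_set Bb).
  congr b; rewrite !scalerDr addrACA -!scalerDl.
  by rewrite [t + _]addrC subrK scale1r.
- by move=> n; have := jC n 0 [set u | b (x + u)]; rewrite linear0; apply.
- move=> y; have := @scaler_continuous _ _ y 0 [set u | b (x + u)].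
  by rewrite scale0r; apply.
Qed.

Lemma fine_hausdorff (K : numFieldType) (E : tvsType K)
    (V : nat -> normedModType K) (j : forall n, {linear V n -> E}) :
  hausdorff_space E -> (forall n, continuous (j n)) ->
  hausdorff_space (fine_lmod j).
Proof.
move=> hE jC p q Fpq; apply: hE => A B Ap Bq.
by apply: Fpq; rewrite nbhs_fineE; exact: nbhs_fine_nbhs.
Qed.

(** The universal property of [E], applied to the identity map from [E] to [E]
    with the fine topology, turns the abstract direct limit into a criterion for
    convex sets to be neighbourhoods of [0]. *)
Lemma silva_nbhs0_convex (K : numFieldType) (E : tvsType K)
    (V : nat -> completeNormedModType K) (s : forall n, {linear V n -> V n.+1})
    (j : forall n, {linear V n -> E}) (W : set E) :
  hausdorff_space E -> silva_limit s j -> convex_set W ->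
  (forall n, nbhs 0 (j n @^-1` W)) -> nbhs 0 W.
Proof.
move=> hE [_ _ jcover _ jC univ] cW jW.
pose F : tvsType K := fine_lmod j.
have hF : hausdorff_space F by exact: fine_hausdorff.
have idC := univ F (idfun : {linear E -> F}) hF (@fine_continuous K E V j).
have := idC 0 W; apply; exists W; last by move=> u; rewrite add0r.
split=> // x; have [n [v <-]] := jcover x.
have vW : nbhs (0 : K^o) [set t | W (j n (t *: v))].
  have := @scaler_continuous _ _ v 0 (j n @^-1` W).
  by rewrite scale0r; apply; exact: jW.
by apply: filterS vW => t /=; rewrite linearZ.
Qed.

(** * Compact convex exhaustions *)

Lemma real_or_complex_archimedean (R : realType) (K : numFieldType) (x : K) :
  real_or_complex R K -> 0 <= x -> exists n : nat, x <= n%:R.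
Proof.
move=> hK; case: K / hK x => x x0.
  by exists (Num.bound x); apply/ltW/archi_boundP.
suff archiC (z : R[i]) : 0 <= z -> exists n : nat, z <= n%:R.
  exact: archiC x0.
case: z => a b; rewrite lecE /= => /andP[/eqP -> a0].
exists (Num.bound a); rewrite -(rmorph_nat (real_complex R)) lecR.
exact/ltW/archi_boundP.
Qed.

(** The bound is taken at least [1] so that it is comparable with, and may be
    added to, other radii. *)
Lemma compact_norm_bounded (K : numFieldType) (V : normedModType K)
    (A : set V) :
  compact A -> exists2 M : K, 1 <= M & forall x, A x -> `|x| <= M.
Proof.
move=> /compact_near_coveringP Ac.
have AM : \forall M \near +oo, A `<=` [set x | `|x| <= M].
  apply: (Ac _ _ (fun M x => `|x| <= M)) => x Ax.
  exists ([set x + y | y in [set y | `|y| <= 1]], [set M | `|x| + 1 <= M]).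
    split; first exact: nbhsT (nbhs0_le ltr01).
    exact: nbhs_pinfty_ge (realD (normr_real x) (real1 K)).
  move=> [_ M] /= [[y y1 <-]]; apply: le_trans.
  by rewrite (le_trans (ler_normD _ _))// lerD2l.
have [M [AM' M1]] := filter_ex (filterI AM (nbhs_pinfty_ge (real1 K))).
by exists M.
Qed.

Lemma closure_convex (K : numFieldType) (V : normedModType K) (A : set V) :
  convex_set A -> convex_set (closure A).
Proof.
move=> /convex_setP cA; apply/convex_setP => t x y t0 t1 Ax Ay N.
have fC : continuous (fun z : V * V => t *: z.1 + (1 - t) *: z.2).
  by move=> z; apply: cvgD; apply: cvgZl_tmp; [exact: cvg_fst|exact: cvg_snd].
move=> /(fC (x, y))[[X Y] [/= /Ax[x' [Ax' Xx']] /Ay[y' [Ay' Yy']]] XYN].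
by exists (t *: x' + (1 - t) *: y'); split; [exact: cA|exact: (XYN (x', y'))].
Qed.

(** An exhaustion of [E] by compact convex sets containing [0], with
    [C n + C n `<=` C n.+1], that generates the locally convex topology: a
    convex set absorbing every [C n] is a neighbourhood of [0]. *)
Record compact_exhaustion (K : numFieldType) (E : tvsType K)
    (C : nat -> set E) : Prop := {
  exh_compact : forall n, compact (C n) ;
  exh_convex : forall n, convex_set (C n) ;
  exh_0 : forall n, C n 0 ;
  exh_add : forall n x y, C n x -> C n y -> C n.+1 (x + y) ;
  exh_cover : forall x, exists n, C n x ;
  exh_nbhs0 : forall W : set E, convex_set W ->
    (forall n, exists2 e : K, 0 < e & forall x, C n x -> W (e *: x)) ->
    nbhs 0 W
}.

Lemma exh_scale (K : numFieldType) (E : tvsType K) (C : nat -> set E)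
    n (e : K) x :
  compact_exhaustion C -> 0 <= e -> e <= 1 -> C n x -> C n (e *: x).
Proof.
move=> CE e0 e1 Cx; have /convex_setP := exh_convex CE (n := n).
by move=> /(_ e x 0 e0 e1 Cx (exh_0 CE n)); rewrite scaler0 addr0.
Qed.

Lemma exh_sub (K : numFieldType) (E : tvsType K) (C : nat -> set E) m n :
  compact_exhaustion C -> (m <= n)%N -> C m `<=` C n.
Proof.
move=> CE mn; rewrite -(subnKC mn); elim: (n - m)%N => [|k IH].
  by rewrite addn0.
move=> x /IH Cx; rewrite addnS -[x]addr0.
by apply: (exh_add CE) => //; exact: (exh_0 CE).
Qed.

Lemma exh_shrink (K : numFieldType) (E : tvsType K) (C : nat -> set E)
    (O S : set E) n :
  compact_exhaustion C -> open O -> compact S -> S `<=` O ->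
  exists e : K, [/\ 0 < e, e <= 1 &
    forall x y, S x -> C n y -> O (x + e *: y)].
Proof.
move=> CE oO cS SO.
have /compact_near_coveringP cSC := compact_setX cS (exh_compact CE (n := n)).
have : \forall e \near (0 : K^o), S `*` C n `<=` [set z | O (z.1 + e *: z.2)].
  apply: (cSC _ (nbhs (0 : K^o)) (fun e z => O (z.1 + e *: z.2))).
  move=> -[x y] [/= /SO Ox _].
  have := @add_scale_continuous _ E ((x, y), 0) O.
  rewrite /= scale0r addr0; apply.
  exact: open_nbhs_nbhs.
move=> /(filterI (nbhs0_le (V:=K^o) ltr01))/nbhs_norm0P[e /= e0 eO].
have e2 : `|e / 2| < e.
  by rewrite gtr0_norm ?divr_gt0// ltr_pdivrMr// ltr_pMr// ltr1n.
have [e1 eSC] := eO _ e2.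
exists (e / 2); split; first by rewrite divr_gt0.
  by rewrite (le_trans _ e1)// real_ler_norm// gtr0_real// divr_gt0.
by move=> x y Sx Cy; exact: (eSC (x, y)).
Qed.

(** Given [W] containing [0] with relatively open traces on the [C n], compact
    convex sets [S n.+1 = S n + e n *: C n] inside [W] are built inductively by
    choosing [e n > 0] small enough.  Their union is convex and absorbs every
    [C n], so it is a neighbourhood of [0] contained in [W]. *)
Lemma exh_komega (K : numFieldType) (E : tvsType K) (C : nat -> set E) :
  compact_exhaustion C -> komega_at 0 C.
Proof.
move=> CE.
split; [exact: (exh_compact CE)| |exact: (exh_0 CE)| |].
- by move=> m n; exact: exh_sub.
- by apply: filterS filterT => x _; have [n Cx] := exh_cover CE x; exists n.
move=> W W0 WC.
pose good n S := [/\ compact S, convex_set S, S 0, S `<=` C n & S `<=` W].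
(* Only the values of [e] at pairs [(n, S n)] with [S n] good matter. *)
have /choice[e eP] (p : nat * set E) : exists e : K, [/\ 0 < e, e <= 1 &
    good p.1 p.2 -> forall x y, p.2 x -> C p.1 y -> W (x + e *: y)].
  have [[cS _ _ SC SW]|nS] := pselect (good p.1 p.2); last by exists 1; split.
  case: (WC p.1.+1) => O oO; rewrite eqEsubset => -[OW WO].
  have [|e [e0 e1 eO]] := @exh_shrink _ _ _ O p.2 p.1 CE oO cS.
    move=> x Sx; have [|] := WO x => //.
    by split; [apply: (exh_sub CE) (SC _ Sx)|exact: SW].
  exists e; split=> // _ x y Sx Cy.
  have [|//] := OW (x + e *: y); split; last exact: eO.
  apply: (exh_add CE) => //; first exact: SC.
  by apply: (exh_scale CE) => //; exact: ltW.
pose S := fix S n : set E := if n is m.+1 then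
  (fun z => z.1 + e (m, S m) *: z.2) @` (S m `*` C m) else [set 0].
have Sgood n : good n (S n).
  elim: n => [|n IH].
    split; [exact: compact_set1| |by []| |by move=> _ ->]; last first.
      by move=> _ ->; exact: (exh_0 CE).
    by apply/convex_setP => t x y _ _ -> ->; rewrite !scaler0 addr0.
  have [e0 e1 /(_ IH) eW] := eP (n, S n); have [cS kS S0 SC SW] := IH; split.
  - apply: continuous_compact; last first.
      by apply: compact_setX => //; exact: (exh_compact CE).
    apply: continuous_subspaceT => z A.
    move=> /(@add_scale_continuous _ E (z, e (n, S n)))[[Z T] [/= Zz Te] ZTA].
    apply: filterS Zz => z' Zz'; apply: (ZTA (z', e (n, S n))).
    by split=> //; exact: nbhs_singleton.
  - apply/convex_setP => t u v t0 t1.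
    move=> [[x y] [/= Sx Cy] <-] [[x' y'] [/= Sx' Cy'] <-].
    exists (t *: x + (1 - t) *: x', t *: y + (1 - t) *: y') => /=.
      split; first by move/convex_setP: kS; exact.
      by move/convex_setP: (exh_convex CE (n := n)); exact.
    by rewrite !scalerDr !scalerA ![_ * e _]mulrC addrACA.
  - exists (0, 0) => /=; last by rewrite scaler0 addr0.
    by split=> //; exact: (exh_0 CE).
  - move=> _ [[x y] [/= Sx Cy] <-]; apply: (exh_add CE) => //; first exact: SC.
    by apply: (exh_scale CE) => //; exact: ltW.
  - by move=> _ [[x y] [/= Sx Cy] <-]; exact: eW.
have Ssub m n : (m <= n)%N -> S m `<=` S n.
  move=> mn; rewrite -(subnKC mn); elim: (n - m)%N => [|k IH].
    by rewrite addn0.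
  move=> x /IH Sx; rewrite addnS.
  exists (x, 0) => /=; last by rewrite scaler0 addr0.
  by split=> //; exact: (exh_0 CE).
suff : nbhs 0 (\bigcup_n S n).
  by apply: filterS => x [n _ Sx]; have [_ _ _ _] := Sgood n; apply.
apply: (exh_nbhs0 CE).
  apply/convex_setP => t x y t0 t1 [m _ Sx] [n _ Sy]; exists (maxn m n) => //.
  have [_ /convex_setP kS _ _ _] := Sgood (maxn m n).
  apply: kS => //; first by apply: Ssub Sx; exact: leq_maxl.
  by apply: Ssub Sy; exact: leq_maxr.
move=> n; have [e0 e1 _] := eP (n, S n); exists (e (n, S n)) => // x Cx.
exists n.+1 => //; exists (0, x) => /=; last by rewrite add0r.
by split=> //; have [] := Sgood n.
Qed.

(** [C n] is the image in [E] of the closure in [V n.+1] of a ball of [V n];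
    the radii grow fast enough to give [C n + C n `<=` C n.+1]. *)
Theorem silva_compact_exhaustion (R : realType) (K : numFieldType)
    (E : tvsType K) :
  real_or_complex R K -> silva_space E ->
  exists C : nat -> set E, compact_exhaustion C.
Proof.
move=> hK [hE [V [s [j sl]]]].
have [_ jstep jcover sc jC _] := sl.
pose Q n r := closure (s n @` [set v | `|v| <= r]).
have Qc n r : 1 <= r -> compact (Q n r).
  move=> r1; rewrite /Q -precompactE; apply: sc.
  have rreal : r \is Num.real by rewrite ger0_real// (le_trans _ r1).
  by apply: filterS (nbhs_pinfty_ge rreal) => M rM v /= /le_trans; apply.
(* [b (n, r)] is a radius in [V n.+1] that is large enough to follow [r] when
   [1 <= r], and is arbitrary otherwise. *)
have /choice[b bP] (p : nat * K) : exists M : K, 1 <= M /\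
    (1 <= p.2 -> forall x y, Q p.1 p.2 x -> Q p.1 p.2 y -> `|x + y| <= M).
  have [r1|] := boolP (1 <= p.2); last by exists 1.
  have [M M1 MQ] := compact_norm_bounded (Qc p.1 _ r1).
  exists (M + M); split; first by rewrite (le_trans M1)// lerDl (le_trans _ M1).
  by move=> _ x y /MQ xM /MQ yM; rewrite (le_trans (ler_normD _ _))// lerD.
pose r := fix r n : K := if n is m.+1 then b (m, r m) else 1.
have r1 n : 1 <= r n by case: n => [|n] //=; have [] := bP (n, r n).
pose C n := j n.+1 @` Q n (r n).
have jQ n v : `|v| <= r n -> C n (j n v).
  move=> vr; exists (s n v); last exact: jstep.
  by apply: subset_closure; exists v.
have Cadd n x y : C n x -> C n y -> C n.+1 (x + y).
  move=> [v Qv <-] [w Qw <-]; rewrite -linearD; apply: jQ.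
  by have [_] := bP (n, r n); apply=> //; exact: r1.
have C0 n : C n 0.
  by rewrite -(linear0 (j n)); apply: jQ; rewrite normr0 (le_trans _ (r1 n)).
exists C; split => //.
- move=> n; apply: continuous_compact; last exact: Qc.
  exact/continuous_subspaceT/jC.
- move=> n; have /closure_convex/convex_setP kQ :
      convex_set (s n @` [set v | `|v| <= r n]).
    apply/convex_setP => t _ _ t0 t1 [v vr <-] [w wr <-].
    exists (t *: v + (1 - t) *: w); last by rewrite linearD !linearZ.
    rewrite /= (le_trans (ler_normD _ _))// !normrZ ger0_norm//.
    rewrite ger0_norm ?subr_ge0//.
    have -> : r n = t * r n + (1 - t) * r n.
      by rewrite -mulrDl addrC subrK mul1r.
    by rewrite lerD// ler_wpM2l// subr_ge0.
  apply/convex_setP => t _ _ t0 t1 [v Qv <-] [w Qw <-].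
  by exists (t *: v + (1 - t) *: w); [exact: kQ|rewrite linearD !linearZ].
- move=> x; have [n [v <-]] := jcover x.
  have [N vN] := real_or_complex_archimedean hK (normr_ge0 v).
  have N0 : 0 < N.+1%:R :> K by rewrite ltr0n.
  have Cv : C n (j n (N.+1%:R^-1 *: v)).
    apply: jQ; rewrite normrZ ger0_norm ?invr_ge0 ?(ltW N0)//.
    rewrite mulrC ler_pdivrMr// (le_trans vN)//.
    by rewrite (@le_trans _ _ N.+1%:R) ?ler_nat// ler_peMl// ltW.
  (* [C n] absorbs [j n v], and sums of up to [N.+1] elements of [C n] remain in
     [C (n + N)]. *)
  suff CN m : C (n + m)%N (j n (N.+1%:R^-1 *: v)) /\
      C (n + m)%N (j n (N.+1%:R^-1 *: v) *+ m.+1).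
    have [_] := CN N; rewrite -linearMn -scaler_nat scalerA divff ?gt_eqF//.
    by rewrite scale1r; exists (n + N)%N.
  elim: m => [|m [IH1 IH2]]; first by rewrite addn0.
  rewrite addnS; split; last by rewrite mulrS; exact: Cadd.
  by rewrite -[j n _]addr0; exact: Cadd.
- move=> W kW WC; apply: (silva_nbhs0_convex hE sl kW) => n.
  have [e e0 eW] := WC n; apply/nbhs_norm0P; exists e => //= v ve.
  have -> : v = e *: (e^-1 *: v) by rewrite scalerA divff ?gt_eqF// scale1r.
  rewrite /= linearZ /=; apply: eW; apply: jQ.
  rewrite normrZ gtr0_norm ?invr_gt0// mulrC ler_pdivrMr//.
  by rewrite (le_trans (ltW ve))// ler_peMl// ltW.
Qed.

(** * Completeness *)

Theorem corollary1p4 (R : realType) (K : numFieldType)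
    (hK : real_or_complex R K)
    (E : tvsType K) (hE : silva_space E)
    (G : preTopologicalGroupType) (A : set (chart G E))
    (hG : lie_group A) :
  weil_complete G.
Proof.
have [C CE] := silva_compact_exhaustion hK hE.
have [_ [Achart Acover _] [mulC _] _] := hG.
have [c Ac c1] := Acover 1%g.
have [L kL] := komega_at_chart (Achart c Ac) c1 (exh_komega CE).
exact: komega_weil_complete mulC kL.
Qed.
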